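(* For every prime power $q$, $$\frac{\pi^2}{6} - \frac{q}{q-1}\, \mathrm{Li}_2\!\left(\frac{1}{\sqrt{q}}\right) \le \mathcal{F}(\mathcal{I}_q) \le \frac{\pi^2}{6}.$$ In particular, $\mathcal{F}(\mathcal{I}_q) \to \frac{\pi^2}{6}$ as $q \to \infty$ (through prime powers).
   Context: $\mathcal{I}_q$ is the set of monic irreducible polynomials in $\mathbb{F}_q[x]$, and for a set $A$ of nonconstant monic polynomials in $\mathbb{F}_q[x]$, $\mathcal{F}(A) = \sum_{a \in A} \frac{1}{q^{\deg a} \deg a}$. $\mathrm{Li}_2$ is the dilogarithm, $\mathrm{Li}_2(x) = \sum_{k=1}^{\infty} \frac{x^k}{k^2}$. *)

(* Defs.v *)
From HB Require Import structures.
From mathcomp Require Import all_boot all_order all_algebra all_field.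
From mathcomp Require Import all_classical all_reals all_analysis.

Set Implicit Arguments.
Unset Strict Implicit.
Unset Printing Implicit Defensive.

Import Order.TTheory GRing.Theory Num.Theory.
Import numFieldNormedType.Exports.

Local Open Scope classical_set_scope.
Local Open Scope ring_scope.

Definition prime_power (q : nat) : Prop :=
  exists p k : nat, [/\ prime p, (0 < k)%N & q = (p ^ k)%N].

Definition monic_irreducibles (F : finFieldType) : set {poly F} :=
  [set f | f \is monic /\ irreducible_poly f].
Arguments monic_irreducibles F : clear implicits.

(* The sum is unordered and valued in the extended reals, since it may diverge
   for a general A.  Meaningful when A consists of nonconstant polynomials:
   constant ones would contribute 0, as 0^-1 = 0. *)
Definition scriptF (R : realType) (F : finFieldType) (A : set {poly F}) :
    \bar R :=
  \esum_(a in A)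
    (let deg := (size a).-1 in (#|F|%:R ^+ deg * deg%:R)^-1)%:E.

(* The limit is meaningful only where the series converges, i.e. `|x| <= 1. *)
Definition Li2 (R : realType) (x : R) : R :=
  limn [series x ^+ k.+1 / k.+1%:R ^+ 2]_k.

(* The hypothesis on K under which limits along prime powers are stated can be
   satisfied. *)
Lemma prime_power_fields_exist :
  exists K : nat -> finFieldType, forall q, prime_power q -> #|K q| = q.
Proof.
have ex q : exists K : finFieldType, prime_power q -> #|K| = q.
  have [[p [k [pp k0 ->]]]|nq] := pselect (prime_power q).
    by have [K _ cK] := pPrimePowerField pp k0; exists K.
  by exists 'F_2.
by exists (fun q => projT1 (cid (ex q))) => q; exact: projT2 (cid (ex q)).
Qed.

(* Main.v *)
(* Let I_n be the number of monic irreducibles of degree n over F_q.  Since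
   'X^(q^n) - 'X is squarefree and is divisible by exactly those monic
   irreducibles whose degree divides n, comparing degrees gives Gauss's formula
   q^n = \sum_(d | n) d I_d.  Hence n I_n <= q^n, and, as the proper divisors of
   n are at most n/2, q^n - n I_n <= \sum_(d <= n/2) q^d <= q/(q-1) q^(n/2).
   Dividing by q^n n^2 and summing the series \sum_n I_n / (q^n n) gives both
   bounds, by \sum_n 1/n^2 = pi^2/6.

   That last evaluation comes from the sums of 1/sin^2 over the points
   k pi / 2^(n+1), 1 <= k < 2^n, which satisfy A_(n+1) = 4 A_n + 2 and so equal
   2 (4^n - 1) / 3, together with 1/sin^2 x - 1 <= 1/x^2 <= 1/sin^2 x on
   (0, pi/2). *)

Require Import Defs.
From HB Require Import structures.
From mathcomp Require Import all_boot all_order all_algebra all_field.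
From mathcomp Require Import all_classical all_reals all_analysis.
From mathcomp Require Import ring lra.

Set Implicit Arguments.
Unset Strict Implicit.
Unset Printing Implicit Defensive.

Import Order.TTheory GRing.Theory Num.Theory.
Import numFieldNormedType.Exports.

Local Open Scope classical_set_scope.
Local Open Scope ring_scope.

(** * Irreducible factors of ['X^(q^n) - 'X] over the field with q elements *)

Lemma card_finField_pnat (F : finFieldType) : [pchar F].-nat #|F|.
Proof.
have [p pp pF] := finPcharP F.
have -> : #|F| = (p ^ logn p #|F|)%N := card_pprimeChar pF.
by rewrite pnatX pnatE // pF.
Qed.

Lemma expf_card_iter (F : finFieldType) n (x : F) : x ^+ (#|F| ^ n) = x.
Proof.
elim: n => [|n IHn]; first by rewrite expn0 expr1.
by rewrite expnSr exprM IHn expf_card.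
Qed.

Section FrobeniusPoly.
Variable F : finFieldType.

Definition frob_poly n : {poly F} := 'X^(#|F| ^ n) - 'X.

Lemma expn_card_gt1 n : (0 < n)%N -> (1 < #|F| ^ n)%N.
Proof. by move=> n0; rewrite -(exp1n n) ltn_exp2r // finNzRing_gt1. Qed.

Lemma size_frob_poly n : (0 < n)%N -> size (frob_poly n) = (#|F| ^ n).+1.
Proof.
move=> n0; rewrite /frob_poly size_polyDl ?size_polyXn // size_polyN size_polyX.
by rewrite ltnS expn_card_gt1.
Qed.

Lemma frob_poly_neq0 n : (0 < n)%N -> frob_poly n != 0.
Proof. by move=> n0; rewrite -size_poly_gt0 size_frob_poly. Qed.

(** The characteristic divides q^n, so the derivative is the constant -1, which is coprime to
    everything. *)
Lemma separable_frob_poly n : (0 < n)%N -> separable_poly (frob_poly n).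
Proof.
move=> n0; rewrite separable_poly.unlock /= derivB derivXn derivX.
have [p pp pF] := finPcharP F.
have /dvdnP[k ->] : (p %| #|F| ^ n)%N.
  have cF : #|F| = (p ^ logn p #|F|)%N := card_pprimeChar pF.
  rewrite cF -expnM dvdn_exp // muln_gt0 n0 andbT lt0n.
  by apply: contraTneq (finNzRing_gt1 F) => l0; rewrite cF l0.
rewrite mulrnA -[_ *+ p]mulr_natr.
have -> : p%:R = 0 :> {poly F} by rewrite -polyC_natr (pcharf0 pF).
rewrite mulr0 sub0r -scaleN1r coprimepZr ?oppr_eq0 ?oner_eq0 //.
exact: coprimep1.
Qed.

Variables (p : {poly F}) (hI : monic_irreducible_poly p).
Local Notation L := {poly %/ p with hI}.
Local Notation toL := (in_qpoly p : {poly F} -> L).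

Lemma in_qpoly_eq0 r : (toL r == 0) = (p %| r).
Proof.
have [_ pM] := hI; apply/eqP/idP => [/val_eqP /= | hDp].
  by rewrite -Pdiv.IdomainMonic.modpE mk_monicE.
by apply/val_eqP; rewrite /= -Pdiv.IdomainMonic.modpE mk_monicE.
Qed.

Lemma in_qpoly_surj (y : L) : toL (val y) = y.
Proof. by apply: val_inj; exact: in_qpoly_small (size_mk_monic y). Qed.

Lemma dvdp_frob_poly n : (p %| frob_poly n) = (toL 'X ^+ (#|F| ^ n) == toL 'X).
Proof. by rewrite -in_qpoly_eq0 rmorphB rmorphXn subr_eq0. Qed.

(** Raising to the power q^n is additive and multiplicative in characteristic p and fixes the
    scalars. Since [L] is generated over [F] by the class of ['X], it is the identity as soon as it
    fixes that class. *)
Lemma frob_fixed n (y : L) : p %| frob_poly n -> y ^+ (#|F| ^ n) = y.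
Proof.
rewrite dvdp_frob_poly => /eqP Xn; rewrite -(in_qpoly_surj y).
have pn : [pchar L].-nat (#|F| ^ n)%N.
  by rewrite pnatX (eq_pnat _ (pchar_qpoly p)) card_finField_pnat.
elim/poly_ind: (val y) => [|r c IHr].
  by rewrite rmorph0 expr0n gtn_eqF // expn_gt0 (ltnW (finNzRing_gt1 F)).
rewrite rmorphD rmorphM exprDn_pchar // exprMn IHr Xn; congr (_ + _).
by rewrite -rmorphXn -polyC_exp expf_card_iter.
Qed.

(* Elements of F[X]/(p), with p of degree d, are fixed by x |-> x^(q^d), so n may
   be replaced by r = n %% d; and if 0 < r, then p %| 'X^(q^r) - 'X makes all q^d
   elements roots of a polynomial of degree q^r < q^d. *)
Lemma dvdp_frob_polyE n : (p %| frob_poly n) = ((size p).-1 %| n)%N.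
Proof.
have d0 : (0 < (size p).-1)%N.
  by rewrite -ltnS prednK; case: hI => -[] //; case: size.
set d := (size p).-1 in d0 *.
have fixmul k y : (y : L) ^+ (#|F| ^ (k * d)) = y.
  elim: k => [|k IHk]; first by rewrite mul0n expn0 expr1.
  by rewrite mulSn expnD exprM -(card_qfpoly hI) expf_card IHk.
have step : (p %| frob_poly n) = (p %| frob_poly (n %% d)).
  rewrite !dvdp_frob_poly [in LHS](divn_eq n d) expnD exprM.
  by rewrite fixmul.
rewrite step /dvdn; case: (posnP (n %% d)) => [->|r0].
  by rewrite /frob_poly expn0 subrr dvdp0.
apply/negP => pr.
have := @max_poly_roots L ('X^(#|F| ^ (n %% d)) - 'X) (enum L).
rewrite size_polyDl size_polyXn ?size_polyN ?size_polyX; last first.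
  by rewrite ltnS expn_card_gt1.
rewrite -size_poly_eq0 size_polyDl size_polyXn ?size_polyN ?size_polyX;
  last first.
  by rewrite ltnS expn_card_gt1.
rewrite -cardE card_qfpoly enum_uniq ltnS leqNgt ltn_exp2l ?finNzRing_gt1 //.
rewrite ltn_mod d0 => H; have // : false by apply: H => //; apply/allP => y _;
  rewrite rootE !hornerE frob_fixed // subrr.
Qed.

End FrobeniusPoly.

(** * Monic irreducible divisors over an arbitrary field *)

Lemma irreducible_factor (F : fieldType) (p : {poly F}) : (1 < size p)%N ->
  exists r : {poly F}, [/\ r \is monic, irreducible_poly r & r %| p].
Proof.
have [n] := ubnP (size p); elim: n => // n IHn in p *; rewrite ltnS => pn p1.
have p0 : p != 0 by rewrite -size_poly_gt0 ltnW.
have [irr|red] := pselect (irreducible_poly p).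
  have lc0 : (lead_coef p)^-1 != 0 by rewrite invr_eq0 lead_coef_eq0.
  exists ((lead_coef p)^-1 *: p); split.
  - by rewrite monicE lead_coefZ mulVf ?lead_coef_eq0.
  - split=> [|r r1]; first by rewrite size_scale.
    by rewrite dvdpZr // (eqp_rtrans (eqp_scale p lc0)); exact: irr.2.
  - by rewrite dvdpZl.
(* A divisor that is neither constant nor associate to [p] has size strictly between 1 and [size p],
   so the induction hypothesis applies to it. *)
have [r [r1 rp rNp]] :
    exists r : {poly F}, [/\ size r != 1%N, r %| p & ~~ (r %= p)].
  apply: contra_notP red => H; split=> // r r1 rp.
  by apply: contrapT => /negP rNp; apply: H; exists r.
have rlt : (size r < size p)%N.
  by rewrite ltn_neqAle dvdp_leq // andbT dvdp_size_eqp.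
have rgt1 : (1 < size r)%N.
  by rewrite ltn_neqAle eq_sym r1 size_poly_gt0 (dvdpN0 rp).
have [s [sm si sr]] := IHn r (leq_trans rlt pn) rgt1.
by exists s; split=> //; exact: dvdp_trans sr rp.
Qed.

(** Distinct monic irreducibles are coprime: one dividing the other would make them associate, hence
    equal. Gauss's lemma then multiplies the divisors one at a time. *)
Lemma dvdp_prod_irreducible (F : fieldType) (s : seq {poly F}) (Q : {poly F}) :
  uniq s ->
  (forall p, p \in s -> [/\ p \is monic, irreducible_poly p & p %| Q]) ->
  \prod_(p <- s) p %| Q.
Proof.
elim: s => [|p s IHs] /=; first by rewrite big_nil dvd1p.
move=> /andP[ps us] H; rewrite big_cons.
have [pm pirr pQ] := H p (mem_head _ _).
have Hs r : r \in s -> [/\ r \is monic, irreducible_poly r & r %| Q].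
  by move=> rs; apply: H; rewrite inE rs orbT.
rewrite Gauss_dvdp ?pQ ?IHs //.
rewrite big_seq; elim/big_rec: _ => [|r P rs IH]; first exact: coprimep1.
rewrite coprimepMr IH andbT irreducible_poly_coprime //.
have [rm ri rQ] := Hs r rs.
apply: contra ps => pr; suff -> : p = r by [].
apply/eqP; rewrite -eqp_monic //; apply: ri.2 => //.
by rewrite gtn_eqF // pirr.1.
Qed.

Lemma size_prod_neq0 (F : fieldType) (s : seq {poly F}) :
  (forall p, p \in s -> p != 0) ->
  size (\prod_(p <- s) p) = (\sum_(p <- s) (size p).-1).+1.
Proof.
elim: s => [|p s IHs] H; first by rewrite !big_nil size_poly1.
have p0 : p != 0 by apply: H; exact: mem_head.
have Hs r : r \in s -> r != 0 by move=> rs; apply: H; rewrite inE rs orbT.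
rewrite !big_cons size_mul //; last by rewrite -size_poly_gt0 IHs.
by rewrite IHs // addnS /=; case: (size p) (size_poly_gt0 p) => //; rewrite p0.
Qed.

(** * Gauss's formula and the bounds on I_n *)

Section GaussCount.
Variable F : finFieldType.

(** Polynomials of size at most n+1 form the finite type [{poly_n.+1 F}], which makes the list
    computable by filtering; its length is I_n. *)
Definition monic_irreducible_seq n : seq {poly F} :=
  [seq p : {poly F} <- [seq polyn r | r : {poly_n.+1 F}] |
    [&& size p == n.+1, p \is monic & irreducibleb p]].

Lemma mem_monic_irreducible_seq n (p : {poly F}) :
  reflect [/\ size p = n.+1, p \is monic & irreducible_poly p]
    (p \in monic_irreducible_seq n).
Proof.
rewrite mem_filter; apply: (iffP andP).
  by move=> [/and3P[/eqP ? ? /irreducibleP ?] _].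
move=> [sp pm /irreducibleP pirr]; rewrite sp eqxx pm pirr; split=> //.
by apply/mapP; exists (npolyp n.+1 p); rewrite ?mem_enum //= npolypK ?sp.
Qed.

Lemma uniq_monic_irreducible_seq n : uniq (monic_irreducible_seq n).
Proof. by rewrite filter_uniq // map_inj_uniq ?enum_uniq //; exact: val_inj. Qed.

Lemma sum_degree_monic_irreducible n : (0 < n)%N ->
  (\sum_(1 <= d < n.+1 | d %| n) d * size (monic_irreducible_seq d) =
     #|F| ^ n)%N.
Proof.
move=> n0; pose Q := frob_poly F n.
pose s := [seq p : {poly F} <- [seq polyn r | r : {poly_n.+1 F}] |
    [&& p \is monic, irreducibleb p & p %| Q]].
have memsP p : reflect [/\ p \is monic, irreducible_poly p & p %| Q] (p \in s).
  rewrite mem_filter; apply: (iffP andP) => [[/and3P[? /irreducibleP ? ?] _] //|].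
  move=> [pm pirr pQ]; split; first by rewrite pm pQ (introT (irreducibleP _)).
  apply/mapP.
  (* The degree of an irreducible divisor of [Q] divides n, so it is at most n and the enumeration
     misses none. *)
  have sp : (size p <= n.+1)%N.
    move: (pQ); rewrite (dvdp_frob_polyE (pirr, pm)) => /(dvdn_leq n0).
    by case: size.
  by exists (npolyp n.+1 p); rewrite ?mem_enum //= npolypK.
have us : uniq s.
  by rewrite filter_uniq // map_inj_uniq ?enum_uniq //; exact: val_inj.
have Q0 : Q != 0 by exact: frob_poly_neq0.
have /dvdpP[S QE] : \prod_(p <- s) p %| Q.
  by apply: dvdp_prod_irreducible => // p /memsP.
(* The cofactor is constant: an irreducible factor of [S] would divide [Q], hence occur in [s] as
   well, and its square would divide the separable [Q]. *)
have sS : size S = 1%N.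
  apply/eqP; rewrite eqn_leq size_poly_gt0.
  have -> : S != 0 by apply: contraNneq Q0 => S0; rewrite QE S0 mul0r.
  rewrite andbT leqNgt; apply/negP => /irreducible_factor[r [rm ri rS]].
  have rs : r \in s by apply/memsP; split=> //; rewrite QE dvdp_mulr.
  have rsz : size r != 1 by rewrite gtn_eqF // ri.1.
  have := separable_nosquare (separable_frob_poly F n0) (isT : (1 < 2)%N) rsz.
  by rewrite -/Q QE expr2 dvdp_mul // (big_rem r) //= dvdp_mulr.
have degQ : (\sum_(p <- s) (size p).-1 = #|F| ^ n)%N.
  apply: succn_inj; rewrite -(size_frob_poly F n0) -/Q.
  rewrite -size_prod_neq0; last by move=> p /memsP[/monic_neq0].
  rewrite QE size_mul ?sS //; last 2 first.
  - by rewrite -size_poly_gt0 sS.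
  - by apply: contraNneq Q0 => P0; rewrite QE P0 mulr0.
rewrite -degQ.
(* Each degree is written as a sum over the divisors d of n with a single nonzero term; exchanging
   the sums then groups [s] by degree. *)
have -> : (\sum_(p <- s) (size p).-1 =
    \sum_(p <- s) \sum_(1 <= d < n.+1 | d %| n) (size p == d.+1) * d)%N.
  apply: eq_big_seq => p /memsP[pm pirr pQ].
  move: pQ; rewrite (dvdp_frob_polyE (pirr, pm)) => dn.
  have p1 : (0 < (size p).-1)%N by rewrite -subn1 subn_gt0 pirr.1.
  rewrite (big_rem (size p).-1) /=; last first.
    by rewrite mem_index_iota p1 ltnS dvdn_leq.
  rewrite dn prednK ?(ltn_trans _ pirr.1) // eqxx mul1n big1_seq ?addn0 //.
  move=> d /andP[_]; rewrite mem_rem_uniq ?iota_uniq // inE => /andP[/negPf dp _].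
  by case: eqP => // sp; rewrite sp /= eqxx in dp.
rewrite exchange_big /= [LHS]big_seq_cond [RHS]big_seq_cond; apply: eq_bigr => d.
rewrite mem_index_iota => /andP[/andP[d1 dn] ddvd].
rewrite -big_distrl /= mulnC; congr (_ * _)%N.
apply: esym; transitivity (count (fun p : {poly F} => size p == d.+1) s).
  by rewrite -sum1_count [RHS]big_mkcond; apply: eq_bigr => p _; case: eqP.
rewrite -size_filter; apply/perm_size/uniq_perm.
- by rewrite filter_uniq.
- exact: uniq_monic_irreducible_seq.
move=> p; rewrite mem_filter; apply/andP/mem_monic_irreducible_seq.
  by move=> [/eqP sp /memsP[pm pirr _]].
move=> [sp pm pirr]; rewrite sp eqxx; split=> //; apply/memsP; split=> //.
by rewrite (dvdp_frob_polyE (pirr, pm)) sp.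
Qed.

Lemma card_monic_irreducible_le n : (0 < n)%N ->
  (n * size (monic_irreducible_seq n) <= #|F| ^ n)%N.
Proof.
move=> n0; rewrite -sum_degree_monic_irreducible // big_mkcond /=.
by rewrite big_nat_recr //= dvdnn leq_addl.
Qed.

(** The geometric sum, with denominator cleared and q moved across so that no truncated subtraction
    of powers occurs. *)
Lemma sum_expn q m : (0 < q)%N ->
  (q.-1 * (\sum_(1 <= d < m.+1) q ^ d) + q = q ^ m.+1)%N.
Proof.
move=> q0; elim: m => [|m IHm]; first by rewrite big_geq // muln0 expn1.
rewrite big_nat_recr //= mulnDr addnAC IHm [RHS]expnS.
by rewrite -mulSn prednK.
Qed.

(** Gauss's formula with each proper divisor's term bounded by q^d. The factor q-1 clears the
    denominator of the geometric sum and keeps the inequality in the naturals. *)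
Lemma card_monic_irreducible_ge n : (0 < n)%N ->
  (#|F|.-1 * #|F| ^ n <=
     #|F|.-1 * (n * size (monic_irreducible_seq n)) + #|F| * #|F| ^ n./2)%N.
Proof.
move=> n0; have F0 : (0 < #|F|)%N := ltnW (finNzRing_gt1 F).
rewrite -{1}sum_degree_monic_irreducible // big_mkcond /=.
rewrite big_nat_recr //= dvdnn addnC mulnDr leq_add2l -expnS.
rewrite -(sum_expn _ F0); apply: leq_trans (leq_addr _ _).
rewrite leq_mul2l; apply/orP; right.
have hn : (n./2.+1 <= n)%N.
  by rewrite ltn_half_double -addnn -{1}[n]add0n ltn_add2r.
rewrite (big_cat_nat (n := n./2.+1)) //=.
(* A divisor d < n has n = k d with k at least 2, so none lies above n/2. *)
rewrite [X in (_ + X)%N]big1_seq ?addn0; last first.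
  move=> d /andP[_]; rewrite mem_index_iota => /andP[nd dn].
  case: ifP => // /dvdnP[k nE]; exfalso.
  move: dn nd; rewrite nE; case: k {nE} => [|[|k]]; rewrite ?mul0n ?mul1n ?ltnn //.
  move=> _; apply/negP; rewrite -leqNgt geq_half_double -mul2n.
  by rewrite leq_mul2r orbT.
rewrite big_nat_cond [leqRHS]big_nat_cond; apply: leq_sum => d /andP[/andP[d0 _] _].
by case: ifP => // _; exact: card_monic_irreducible_le.
Qed.

End GaussCount.

(** * The sum of the inverse squares *)

Section Basel.
Variable R : realType.
Implicit Types (x : R) (n : nat).

Lemma sin_le x : 0 < x -> sin x <= x.
Proof.
move=> x0.
have [c _] := @MVT R sin cos 0 x x0 (fun y _ => is_derive_sin y)
  (continuous_subspaceT (@continuous_sin R)).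
by rewrite sin0 !subr0 => ->; rewrite ler_piMl ?cos_le1 // ltW.
Qed.

(** By the mean value theorem, since the derivative 1/cos^2 of tan is at least 1. *)
Lemma le_tan x : 0 < x < pi / 2 -> x <= tan x.
Proof.
move=> /andP[x0 xpi].
have cosn y : 0 <= y -> y <= x -> 0 < cos y.
  move=> y0 yx; apply: cos_gt0_pihalf; rewrite (le_lt_trans yx) // andbT.
  by rewrite (lt_le_trans _ y0) // oppr_lt0 divr_gt0 ?pi_gt0.
have [||c] := @MVT R tan (fun y => (cos y) ^- 2) 0 x x0.
- move=> y; rewrite in_itv /= => /andP[y0 yx].
  by apply: is_derive_tan; rewrite gt_eqF // cosn // ltW.
- apply: continuous_in_subspaceT => y; rewrite inE /= in_itv /= => /andP[y0 yx].
  by apply: continuous_tan; rewrite gt_eqF // cosn.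
- rewrite in_itv /= => /andP[/ltW c0 /ltW cx]; rewrite tan0 !subr0 => ->.
  rewrite ler_peMl ?(ltW x0) // invf_ge1 ?exprn_gt0 ?cosn //.
Qed.

(** Invert and square sin x <= x <= tan x, using 1/sin^2 x - 1 = 1/tan^2 x. *)
Lemma inv_sqr_bounds x : 0 < x < pi / 2 ->
  (sin x) ^- 2 - 1 <= x ^- 2 <= (sin x) ^- 2.
Proof.
move=> xpi; have /andP[x0 _] := xpi.
have s0 := sin_gt0_pihalf xpi.
have c0 : 0 < cos x.
  apply: cos_gt0_pihalf; move: xpi => /andP[_ ->]; rewrite andbT.
  by rewrite (lt_trans _ x0) // oppr_lt0 divr_gt0 ?pi_gt0.
apply/andP; split; last first.
  by rewrite lef_pV2 ?posrE ?exprn_gt0 // ler_sqr ?nnegrE ?sin_le // ltW.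
have -> : sin x ^- 2 - 1 = (tan x) ^- 2.
  rewrite /tan expr_div_n invf_div; apply: (@mulIf _ (sin x ^+ 2)).
    by rewrite expf_neq0 // gt_eqF.
  by rewrite mulrBl mulVf ?mulfVK ?expf_neq0 ?gt_eqF // mul1r cos2sin2.
have t0 : 0 < tan x by rewrite divr_gt0.
by rewrite lef_pV2 ?posrE ?exprn_gt0 // ler_sqr ?nnegrE ?le_tan // ltW.
Qed.

Definition csc2_sum n : R :=
  \sum_(1 <= k < 2 ^ n) (sin (k%:R * (pi / 2 ^+ n.+1))) ^- 2.

Lemma csc2_double x : sin x != 0 -> cos x != 0 ->
  4 * (sin (x *+ 2)) ^- 2 = (sin x) ^- 2 + (cos x) ^- 2.
Proof.
move=> s0 c0; rewrite sin_mulr2n -[LHS]mul1r -{1}(cos2Dsin2 x).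
by field; rewrite s0 c0.
Qed.

(* With t = pi / 2^(n+2), the angles k t and (2^(n+1) - k) t add up to pi / 2, so
   csc2_double turns their two terms into 4 / sin^2 (2 k t); the unpaired middle
   term is 1 / sin^2 (pi / 4) = 2. *)
Lemma csc2_sumS n : csc2_sum n.+1 = 4 * csc2_sum n + 2.
Proof.
have p2 : (0 < 2 ^ n)%N by rewrite expn_gt0.
pose t : R := pi / 2 ^+ n.+2.
have t0 : 0 < t by rewrite divr_gt0 ?pi_gt0 ?exprn_gt0.
have tE : (2 ^ n)%:R * t = pi / 4.
  by rewrite /t natrX exprSr exprSr; field; rewrite ?expf_neq0 //.
have tE2 : (2 ^ n.+1)%:R * t = pi / 2.
  by rewrite expnSr natrM mulrAC tE; field.
rewrite /csc2_sum -/t.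
have -> : pi / 2 ^+ n.+1 = t *+ 2 :> R.
  by rewrite /t [in RHS]exprS invfM -mulr_natr; field; rewrite expf_neq0.
have e1 : (2 ^ n <= 2 ^ n.+1)%N by rewrite leq_exp2l.
rewrite (big_cat_nat (n := (2 ^ n)%N)) //= (big_ltn (m := 2 ^ n)); last first.
  by rewrite ltn_exp2l.
rewrite [X in (sin X)]tE.
have -> : sin (pi / 4) ^- 2 = 2 :> R.
  have q0 : 0 < pi / 4 :> R by rewrite divr_gt0 ?pi_gt0.
  have cE : cos (pi / 4) = sin (pi / 4) :> R.
    by rewrite -cosBpihalf -cosN; congr cos; field.
  have s0 : sin (pi / 4) != 0 :> R.
    rewrite gt_eqF // sin_gt0_pihalf // q0 /= ltr_pM2l ?pi_gt0 //.
    by rewrite ltf_pV2 ?posrE // ltr_nat.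
  have := @csc2_double (pi / 4); rewrite cE => /(_ s0 s0).
  have -> : (pi / 4) *+ 2 = pi / 2 :> R by field.
  by rewrite sin_pihalf expr1n invr1; lra.
rewrite -[(2 ^ n).+1]add1n [X in _ + (_ + X)]big_addn.
have -> : (2 ^ n.+1 - 2 ^ n = 2 ^ n)%N by rewrite expnS mul2n -addnn addnK.
rewrite [2 + _]addrC addrA; congr (_ + _).
rewrite [X in _ + X]big_nat_rev /= -big_split /= big_distrr /=.
rewrite big_nat_cond [RHS]big_nat_cond.
apply: eq_bigr => k /andP[/andP[k1 kn] _].
have -> : (1 + 2 ^ n - k.+1 + 2 ^ n)%:R * t = pi / 2 - k%:R * t.
  rewrite -tE2 -mulrBl -natrB; last by rewrite (leq_trans (ltnW kn)).
  congr (_%:R * _); rewrite add1n subSS expnS mul2n -addnn.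
  by rewrite addnC -addnBA // ltnW.
have kt : 0 < k%:R * t < pi / 2.
  rewrite mulr_gt0 ?ltr0n //= -tE2 ltr_pM2r // ltr_nat.
  exact: leq_trans kn e1.
rewrite sinB sin_pihalf cos_pihalf mul1r mul0r subr0 mulrnAr csc2_double //.
- by rewrite gt_eqF // sin_gt0_pihalf.
- rewrite gt_eqF // cos_gt0_pihalf //; move: kt => /andP[kt0 ->].
  by rewrite (lt_trans _ kt0) // oppr_lt0 divr_gt0 ?pi_gt0.
Qed.

Lemma csc2_sumE n : csc2_sum n = 2 / 3 * (4 ^+ n - 1).
Proof.
elim: n => [|n IHn]; first by rewrite /csc2_sum big_geq // expr0 subrr mulr0.
by rewrite csc2_sumS IHn [in RHS]exprS; field.
Qed.

(** [inv_sqr_bounds] is summed over the angles k t with t = pi / 2^(n+1), then multiplied by t^2 =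
    pi^2 / (4 4^n). The error terms are t^2 2^n and 2 t^2 / 3. *)
Lemma basel_bounds n :
  pi ^+ 2 / 6 - (pi ^+ 2 / 4 * (1 / 2 ^+ n) + pi ^+ 2 / 6 * (1 / 4 ^+ n)) <=
    \sum_(1 <= k < 2 ^ n) (k%:R ^- 2 : R) <= pi ^+ 2 / 6.
Proof.
have p0 : (pi : R) != 0 by rewrite gt_eqF // pi_gt0.
pose t : R := pi / 2 ^+ n.+1.
have t0 : 0 < t by rewrite divr_gt0 ?pi_gt0 ?exprn_gt0.
pose S : R := \sum_(1 <= k < 2 ^ n) k%:R ^- 2.
have tS : t ^- 2 * S = \sum_(1 <= k < 2 ^ n) (k%:R * t) ^- 2.
  rewrite big_distrr; apply: eq_bigr => k _.
  by rewrite [in RHS]exprMn [in RHS]invfM [RHS]mulrC.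
have kt k : (1 <= k < 2 ^ n)%N -> 0 < k%:R * t < pi / 2.
  move=> /andP[k1 kn].
  have -> : pi / 2 = (2 ^ n)%:R * t.
    by rewrite /t natrX exprS; field; rewrite expf_neq0.
  by rewrite mulr_gt0 ?ltr0n //= ltr_pM2r // ltr_nat.
have up : t ^- 2 * S <= csc2_sum n.
  rewrite tS; apply: ler_sum_nat => k /kt /inv_sqr_bounds /andP[_ //].
(* There are 2^n - 1 terms, each losing 1; the loss is rounded up to 2^n. *)
have lo : csc2_sum n - 2 ^+ n <= t ^- 2 * S.
  apply: (@le_trans _ _ (csc2_sum n - \sum_(1 <= k < 2 ^ n) 1)).
    by rewrite lerB // sumr_const_nat -natrX ler_nat; exact: leq_subr.
  rewrite tS -sumrB; apply: ler_sum_nat => k /kt /inv_sqr_bounds /andP[//].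
rewrite -/S; rewrite csc2_sumE in lo up.
have t2 : 0 < t ^+ 2 by rewrite exprn_gt0.
have SE : S = t ^+ 2 * (t ^- 2 * S) by rewrite mulrA mulfV ?mul1r // gt_eqF.
have q4 : (4 : R) ^+ n = 2 ^+ n * 2 ^+ n by rewrite -exprMn -natrM.
have q2 : (2 : R) ^+ n != 0 by rewrite expf_neq0.
have t2E : t ^+ 2 = pi ^+ 2 / 4 / 4 ^+ n.
  by rewrite /t [2 ^+ n.+1]exprS q4; move: (2 ^+ n) q2 => z z0; field.
apply/andP; split.
  rewrite SE; apply: le_trans (ler_wpM2l (ltW t2) lo); rewrite t2E q4.
  rewrite le_eqVlt; apply/orP; left; apply/eqP.
  by move: (2 ^+ n) q2 => z z0; field.
rewrite SE; apply: le_trans (ler_wpM2l (ltW t2) up) _; rewrite t2E.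
have -> : pi ^+ 2 / 4 / 4 ^+ n * (2 / 3 * (4 ^+ n - 1)) =
    pi ^+ 2 / 6 - pi ^+ 2 / 6 / 4 ^+ n :> R.
  by rewrite q4; move: (2 ^+ n) q2 => z z0; field.
by rewrite lerBlDr lerDl divr_ge0 ?exprn_ge0 // divr_ge0 ?sqr_ge0.
Qed.

End Basel.

Lemma basel (R : realType) :
  [series k.+1%:R ^- 2]_k @ \oo --> (pi ^+ 2 / 6 : R).
Proof.
set u := [series _]_k.
(* The series is indexed from 0, so its partial sum at n-1 stops at k = n-1; for n = 0 both sides
   are empty. *)
have uE n : u n.-1 = \sum_(1 <= k < n) (k%:R ^- 2 : R).
  by case: n => [|n]; rewrite /u seriesEnat /= ?big_add1 // !big_geq.
have u_nd : nondecreasing_seq u.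
  by apply: nondecreasing_series => k _; rewrite invr_ge0 exprn_ge0.
have u_le n : u n <= pi ^+ 2 / 6.
  have /andP[_ le2n] := @basel_bounds R n.+1.
  apply: le_trans le2n; rewrite -uE; apply: u_nd.
  rewrite -ltnS prednK ?expn_gt0 //.
  exact: ltn_trans (ltnSn n) (ltn_expl _ _).
have u_cvg : cvgn u.
  by apply: nondecreasing_is_cvgn => //; exists (pi ^+ 2 / 6) => _ [n _ <-].
suff <- : limn u = pi ^+ 2 / 6 by [].
apply/eqP; rewrite eq_le; apply/andP; split.
  by apply: limr_le => //; exact: nearW.
have geo (a : R) (z : nat) : (1 < z)%N ->
    (fun n => a * (1 / z%:R ^+ n)) @ \oo --> (0 : R).
  move=> z1; have := @cvg_geometric R a z%:R^-1.
  rewrite /geometric /=.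
  under [X in _ -> X @ _ --> _]eq_fun do rewrite div1r -exprVn.
  by apply; rewrite ger0_norm ?invr_ge0 // invf_lt1 ?ltr1n // ltr0n ltnW.
(* The lower bounds at the indices 2^n tend to pi^2/6, and by monotonicity of [u] each of them lies
   below its limit. *)
have lb : (fun n => pi ^+ 2 / 6 - (pi ^+ 2 / 4 * (1 / 2%:R ^+ n) +
      pi ^+ 2 / 6 * (1 / 4%:R ^+ n))) @ \oo --> (pi ^+ 2 / 6 : R).
  rewrite -[X in _ --> X]subr0; apply: cvgB; first exact: cvg_cst.
  by rewrite -[X in _ --> X]addr0; apply: cvgD; exact: geo.
rewrite -(cvg_lim _ lb) //; apply: limr_le.
  by apply/cvg_ex; exists (pi ^+ 2 / 6).
apply: nearW => n; have /andP[le1 _] := @basel_bounds R n.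
by apply: le_trans le1 _; rewrite -uE; exact: nondecreasing_cvgn_le.
Qed.

Lemma is_cvg_series_inv_sqr (R : realType) :
  cvgn [series k.+1%:R ^- 2 : R]_k.
Proof. by apply/cvg_ex; exists (pi ^+ 2 / 6); exact: basel. Qed.

(** * The sum over monic irreducibles as a series over degrees *)

Section Density.
Variables (R : realType) (F : finFieldType).
Local Notation q := (#|F|%:R : R).
Local Notation I_ n := (size (@monic_irreducible_seq F n)).

(** The joint contribution of all monic irreducibles of degree k+1; the shift skips degree 0, where
    there are none. *)
Definition degree_term k : R := (I_ k.+1)%:R / (q ^+ k.+1 * k.+1%:R).

(** The terms are nonnegative, so the unordered sum may be split along the disjoint classes of equal
    degree, on each of which the summand is constant. *)
Lemma scriptF_series :
  scriptF R (monic_irreducibles F) = (\sum_(0 <= k <oo) (degree_term k)%:E)%E.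
Proof.
pose A k : set {poly F} := [set` monic_irreducible_seq F k.+1].
have -> : monic_irreducibles F = \bigcup_k A k.
  apply/seteqP; split=> [p [pm pirr]|p [k _] /mem_monic_irreducible_seq[_ //]].
  (* The degree is the size minus 1, and the index is the degree minus 1. *)
  exists (size p).-2 => //; apply/mem_monic_irreducible_seq; split=> //.
  by case: (size p) pirr.1 => [|[]].
rewrite /scriptF nneseries_sum_bigcup /=.
- apply: eq_eseriesr => k _.
  rewrite esum_fset; [|exact: finite_seq|]; last first.
    by move=> p _; rewrite lee_fin invr_ge0 mulr_ge0 ?exprn_ge0.
  rewrite -(fsbig_seq _ _ (uniq_monic_irreducible_seq F k.+1)).
  under eq_big_seq => p /mem_monic_irreducible_seq[-> _ _] do rewrite /=.
  rewrite sumEFin big_const_seq count_predT iter_addr_0.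
  by rewrite /degree_term mulr_natl.
- move=> i j _ _ [p []].
  move=> /mem_monic_irreducible_seq[si _ _] /mem_monic_irreducible_seq[sj _ _].
  by move: sj; rewrite si => -[].
- by move=> p; rewrite lee_fin invr_ge0 mulr_ge0 ?exprn_ge0.
Qed.

Lemma natr_card_gt1 : 1 < q.
Proof. by rewrite ltr1n finNzRing_gt1. Qed.

Lemma degree_term_ge0 k : 0 <= degree_term k.
Proof. by rewrite divr_ge0 // mulr_ge0 ?exprn_ge0. Qed.

Lemma degree_term_le k : degree_term k <= k.+1%:R ^- 2.
Proof.
have q0 : 0 < q := lt_trans ltr01 natr_card_gt1.
have := card_monic_irreducible_le F (ltn0Sn k).
rewrite -(ler_nat R) natrM natrX => le.
rewrite /degree_term ler_pdivrMr ?mulr_gt0 ?exprn_gt0 //.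
have -> : k.+1%:R ^- 2 * (q ^+ k.+1 * k.+1%:R) = q ^+ k.+1 / k.+1%:R.
  rewrite mulrC -mulrA; congr (_ * _).
  have : k.+1%:R != 0 :> R by rewrite pnatr_eq0.
  by move: (k.+1%:R : R) => x x0; field.
by rewrite ler_pdivlMr // mulrC.
Qed.

(** This is [card_monic_irreducible_ge] divided by (q-1) q^K K^2, with K = k+1. *)
Lemma degree_term_ge k :
  k.+1%:R ^- 2 <= degree_term k +
    q / (q - 1) * ((1 / Num.sqrt q) ^+ k.+1 / k.+1%:R ^+ 2).
Proof.
have q0 : 0 < q := lt_trans ltr01 natr_card_gt1.
have q1 : 0 < q - 1 by rewrite subr_gt0 natr_card_gt1.
set K := k.+1; pose r := Num.sqrt q.
have r1 : 1 <= r by rewrite -[1]sqrtr1 ler_wsqrtr // ltW // natr_card_gt1.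
have r0 : 0 < r := lt_le_trans ltr01 r1.
have qE : q = r ^+ 2 by rewrite sqr_sqrtr // ltW.
have qK : 0 < q ^+ K by rewrite exprn_gt0.
(* With r = sqrt q, the left side is r to the even number 2 floor(K/2) <= K, and the right side is
   r^K. *)
have half : q ^+ K./2 <= (1 / r) ^+ K * q ^+ K.
  rewrite -exprMn {2}qE expr2 mulrA div1r mulVf ?mul1r; last by rewrite gt_eqF.
  rewrite qE -exprM mul2n ler_weXn2l // -[leqRHS](odd_double_half K).
  exact: leq_addl.
have := card_monic_irreducible_ge F (ltn0Sn k).
rewrite -(ler_nat R) natrD !natrM !natrX -subn1 natrB; last first.
  exact: ltnW (finNzRing_gt1 F).
rewrite -/K => le.
have {half}le : (q - 1) * q ^+ K <=
    (q - 1) * (K%:R * (I_ K)%:R) + q * ((1 / r) ^+ K * q ^+ K).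
  by apply: le_trans le _; rewrite lerD2l ler_pM2l.
rewrite -/r.
rewrite -(ler_pM2r (mulr_gt0 (mulr_gt0 q1 qK) (exprn_gt0 2 (ltr0Sn R k)))) -/K.
have K0 : K%:R != 0 :> R by rewrite pnatr_eq0.
have q1' : q - 1 != 0 by rewrite gt_eqF.
have qK' : q ^+ K != 0 by rewrite gt_eqF.
rewrite /degree_term -/K.
move: le q1' qK' K0.
move: q (q ^+ K) ((1 / r) ^+ K) (I_ K)%:R (K%:R : R) => w y z i x le w0 y0 x0.
have -> : x ^- 2 * ((w - 1) * y * x ^+ 2) = (w - 1) * y by field.
have -> : (i / (y * x) + w / (w - 1) * (z / x ^+ 2)) * ((w - 1) * y * x ^+ 2) =
    (w - 1) * (x * i) + w * (z * y) by field; rewrite x0 w0 y0.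
exact: le.
Qed.

(** Comparison with the inverse squares makes the series converge, so the extended-real sum is
    finite and real limits can be compared. *)
Lemma scriptF_lim : cvgn (series degree_term) /\
   scriptF R (monic_irreducibles F) = (limn (series degree_term))%:E.
Proof.
have cb := @is_cvg_series_inv_sqr R.
have ct : cvgn (series degree_term).
  apply: series_le_cvg cb => [k|k|k]; rewrite ?degree_term_ge0 ?degree_term_le //.
  by rewrite invr_ge0 exprn_ge0.
split=> //; rewrite scriptF_series -EFin_lim //.
by congr (limn _); apply/funext => n /=; rewrite /series /= sumEFin.
Qed.

End Density.

(** * Dilogarithm estimates and the limit in q *)

Lemma Li2_le (R : realType) (x : R) : 0 <= x <= 1 ->
  cvgn [series x ^+ k.+1 / k.+1%:R ^+ 2]_k /\ Li2 x <= x * (pi ^+ 2 / 6).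
Proof.
move=> /andP[x0 x1].
have cb := @is_cvg_series_inv_sqr R.
(* The crude bound x^(k+1) <= x on [0, 1] suffices: being linear in x, it forces the error to vanish
   when x = 1/sqrt q tends to 0. *)
have le k : x ^+ k.+1 / k.+1%:R ^+ 2 <= x * k.+1%:R ^- 2.
  by rewrite ler_wpM2r ?invr_ge0 ?exprn_ge0 // exprS ler_piMr // exprn_ile1.
have cx := is_cvg_seriesZ (k := x) cb.
have cl : cvgn [series x ^+ k.+1 / k.+1%:R ^+ 2]_k.
  apply: series_le_cvg le cx => k.
    by rewrite divr_ge0 ?exprn_ge0.
  by rewrite mulr_ge0 // invr_ge0 exprn_ge0.
split=> //; rewrite /Li2; apply: le_trans (lim_series_le cl cx le) _.
by rewrite lim_seriesZ // (cvg_lim _ (@basel R)).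
Qed.

Lemma inv_sqrt_itv (R : realType) (x : R) : 1 <= x -> 0 <= 1 / Num.sqrt x <= 1.
Proof.
move=> x1; have r1 : 1 <= Num.sqrt x by rewrite -{1}[1]sqrtr1 ler_wsqrtr.
by rewrite div1r invr_ge0 sqrtr_ge0 invf_le1 // (lt_le_trans ltr01).
Qed.

Lemma scriptF_bounds (R : realType) (F : finFieldType) (q : R := #|F|%:R) :
  ((pi ^+ 2 / 6 - q / (q - 1) * Li2 (1 / Num.sqrt q))%:E
     <= scriptF R (monic_irreducibles F) <= (pi ^+ 2 / 6)%:E)%E.
Proof.
have q1 : 1 < q := natr_card_gt1 R F.
have q0 : 0 < q := lt_trans ltr01 q1.
have [cF ->] := scriptF_lim R F.
have [|cL _] := @Li2_le R (1 / Num.sqrt q).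
  by apply: inv_sqrt_itv; exact: ltW.
have cb := @is_cvg_series_inv_sqr R.
have bE := cvg_lim (@Rhausdorff R) (@basel R).
rewrite !lee_fin; apply/andP; split; last first.
  by rewrite -bE; apply: lim_series_le => // k; exact: degree_term_le.
rewrite lerBlDr -bE.
have cZ := is_cvg_seriesZ (k := q / (q - 1)) cL.
have -> : q / (q - 1) * Li2 (1 / Num.sqrt q) = limn (series (q / (q - 1) *:
    (fun k => (1 / Num.sqrt q) ^+ k.+1 / k.+1%:R ^+ 2))).
  by rewrite lim_seriesZ.
rewrite -lim_seriesD //; apply: lim_series_le => //; first exact: is_cvg_seriesD.
by move=> k; exact: degree_term_ge.
Qed.

Lemma invr_sqrt_nat_cvg (R : realType) :
  (1 / Num.sqrt n%:R : R) @[n --> \oo] --> (0 : R).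
Proof.
have inv0 : (n%:R^-1 : R) @[n --> \oo] --> (0 : R).
  apply/gtr0_cvgV0; last exact: cvgr_idn.
  by exists 1%N => // n /= n1; rewrite ltr0n.
rewrite -[X in _ --> X]sqrtr0.
(* Written as sqrt(1/n), the sequence converges by continuity of the square root at 0. *)
under eq_fun do rewrite div1r -sqrtrV //.
apply: continuous_cvg inv0; exact: sqrt_continuous.
Qed.

Theorem proposition2p2 (R : realType) :
  (forall (q : nat) (F : finFieldType), prime_power q -> #|F| = q ->
     ((pi ^+ 2 / 6 - q%:R / (q%:R - 1) * Li2 (1 / Num.sqrt q%:R))%:E
        <= scriptF R (monic_irreducibles F))%E /\
     (scriptF R (monic_irreducibles F) <= (pi ^+ 2 / 6)%:E)%E)
  /\
  (forall K : nat -> finFieldType,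
     (forall q : nat, prime_power q -> #|K q| = q) ->
     scriptF R (monic_irreducibles (K q))
       @[q --> within [set q | prime_power q] \oo] --> (pi ^+ 2 / 6)%:E).
Proof.
split=> [q F _ <-|K cardK]; first by apply/andP; exact: scriptF_bounds.
(* The factor 2 bounds q/(q-1) for q >= 2, and [Li2_le] replaces the dilogarithm, giving a lower
   bound with an evident limit. *)
apply: (@squeeze_cvge _ _ _ _
  (fun q => (pi ^+ 2 / 6 - 2 * (1 / Num.sqrt q%:R * (pi ^+ 2 / 6)))%:E) _
  (fun=> (pi ^+ 2 / 6)%:E)); last exact: cvg_cst.
- rewrite near_withinE; apply: nearW => q /= /cardK cq.
  have /andP[lo ->] := scriptF_bounds R (K q); rewrite andbT.
  apply: le_trans lo; rewrite lee_fin lerB // cq.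
  have q2 : 2 <= q%:R :> R by rewrite ler_nat -cq finNzRing_gt1.
  have [|_ le] := @Li2_le R (1 / Num.sqrt q%:R).
    by apply: inv_sqrt_itv; rewrite ler1n -cq ltnW // finNzRing_gt1.
  have q1 : 0 < q%:R - 1 :> R by rewrite subr_gt0 (lt_le_trans _ q2) // ltr1n.
  apply: (@le_trans _ _
    (q%:R / (q%:R - 1) * (1 / Num.sqrt q%:R * (pi ^+ 2 / 6)))).
    by rewrite ler_wpM2l // divr_ge0 // ltW.
  rewrite ler_wpM2r // ?mulr_ge0 ?invr_ge0 ?sqrtr_ge0 ?sqr_ge0 ?pi_ge0 //.
  by rewrite ler_pdivrMr // mulrBr mulr1 mulr_natl mulr2n; lra.
(* The lower bound converges along all naturals, hence along prime powers. *)
- apply: cvg_within_filter; apply: cvg_EFin; first exact: nearW.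
  rewrite [X in _ --> X](_ : _ = pi ^+ 2 / 6 - 2 * (0 * (pi ^+ 2 / 6)));
    last first.
    by rewrite mul0r mulr0 subr0.
  apply: cvgB; first exact: cvg_cst.
  apply: cvgMr; apply: cvgMl; exact: invr_sqrt_nat_cvg.
Qed.
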